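(* Let $R$ be a commutative ring with $1\neq 0$ and let $Q$ be a proper ideal of $R$. Then the following conditions are equivalent: (1) $Q$ is special 2-absorbing primary; (2) for every $a,b\in R$, either $ab\in Q$ or $(Q:_R ab)=(Q:_R a)$ or $(Q:_R ab)\subseteq(\sqrt{Q}:_R b)$; (3) for every $a,b\in R$ and every ideal $I$ of $R$, $abI\subseteq Q$ implies that either $ab\in Q$ or $aI\subseteq Q$ or $bI\subseteq\sqrt{Q}$; (4) for every $a\in R$ and every ideal $I$ of $R$, either $aI\subseteq Q$ or $(Q:_R aI)\subseteq(Q:_R a)\cup(\sqrt{Q}:_R I)$; (5) for every $a\in R$ and every ideal $I$ of $R$, either $aI\subseteq Q$ or $(Q:_R aI)=(Q:_R a)$ or $(Q:_R aI)\subseteq(\sqrt{Q}:_R I)$; (6) for every $a\in R$ and every pair of ideals $I,J$ of $R$, $aIJ\subseteq Q$ implies that either $aI\subseteq Q$ or $IJ\subseteq\sqrt{Q}$ or $aJ\subseteq Q$; (7) for every pair of ideals $I,J$ of $R$, either $IJ\subseteq\sqrt{Q}$ or $(Q:_R IJ)\subseteq(Q:_R I)\cup(Q:_R J)$; (8) for every pair of ideals $I,J$ of $R$, either $IJ\subseteq\sqrt{Q}$ or $(Q:_R IJ)=(Q:_R I)$ or $(Q:_R IJ)=(Q:_R J)$; (9) for all ideals $I,J,K$ of $R$, $IJK\subseteq Q$ implies that either $IJ\subseteq\sqrt{Q}$ or $IK\subseteq Q$ or $JK\subseteq Q$.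
   Context: All rings are commutative with $1\neq 0$. A proper ideal $Q$ of $R$ is special 2-absorbing primary if whenever $a,b,c\in R$ satisfy $abc\in Q$, $ab\notin Q$ and $ac\notin\sqrt{Q}$, then $bc\in Q$. Here $\sqrt{Q}$ is the radical of $Q$. For ideals $I,J$ of $R$, $(I:_R J)=\{r\in R : rJ\subseteq I\}$, and for $x\in R$, $(I:_R x)=\{r\in R : rx\in I\}$. *)

(* Defs.v *)
From mathcomp Require Import all_boot all_order all_algebra.
From mathcomp Require Import boolp classical_sets.

Set Implicit Arguments.
Unset Strict Implicit.
Unset Printing Implicit Defensive.

Import GRing.Theory.
Local Open Scope classical_set_scope.
Local Open Scope ring_scope.

(* [idealr_closed] only describes proper ideals, whereas the whole ring must
   be allowed here; [proper_idealP] below relates the two notions. *)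
Definition is_ideal (R : comNzRingType) (I : set R) : Prop :=
  [/\ I 0, forall x y, I x -> I y -> I (x + y) & forall r x, I x -> I (r * x)].

Definition is_proper_ideal (R : comNzRingType) (I : set R) : Prop :=
  is_ideal I /\ I <> [set: R].

Definition radical (R : comNzRingType) (I : set R) : set R :=
  [set x | exists2 n : nat, (0 < n)%N & I (x ^+ n)].

(* Already an ideal when [I] is one, so no generation is needed. *)
Definition elt_mul (R : comNzRingType) (a : R) (I : set R) : set R :=
  [set a * x | x in I].

Definition ideal_mul (R : comNzRingType) (I J : set R) : set R :=
  smallest (@is_ideal R) [set x * y | x in I & y in J].

Definition colon (R : comNzRingType) (I J : set R) : set R :=
  [set r | elt_mul r J `<=` I].

Definition colon_elt (R : comNzRingType) (I : set R) (x : R) : set R :=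
  [set r | I (r * x)].

Definition special_2_absorbing_primary (R : comNzRingType) (Q : set R) : Prop :=
  is_proper_ideal Q /\
  forall a b c : R,
    Q (a * b * c) -> ~ Q (a * b) -> ~ radical Q (a * c) -> Q (b * c).

Lemma proper_idealP (R : comNzRingType) (I : set R) :
  is_proper_ideal I <-> idealr_closed [in I].
Proof.
split=> [[[I0 ID IM] nT]|[I0 I1 IM]].
  split; first exact: mem_set.
    apply/negP => /set_mem I1; apply: nT; apply/seteqP; split=> // x _.
    by rewrite -[x]mulr1; exact: IM.
  by move=> a x y /set_mem Ix /set_mem Iy; apply: mem_set; apply: ID => //; exact: IM.
have I0' : I 0 := set_mem I0.
split; last by move=> IT; move/negP: I1; apply; apply: mem_set; rewrite IT.
split=> // [x y Ix Iy|r x Ix]; apply: set_mem.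
  by rewrite -[x]mul1r; apply: IM; exact: mem_set.
by rewrite -[r * x]addr0; apply: IM; exact: mem_set.
Qed.

(* Main.v *)
Require Import Defs.
From mathcomp Require Import all_boot all_order all_algebra.
From mathcomp Require Import boolp classical_sets.

Set Implicit Arguments.
Unset Strict Implicit.
Unset Printing Implicit Defensive.

Import GRing.Theory.
Local Open Scope classical_set_scope.
Local Open Scope ring_scope.

(** Writing $abc \in Q$ as $c \in (Q : ab)$, the special 2-absorbing primary
condition says that $ab \notin Q$ forces
$(Q : ab) \subseteq (Q : a) \cup (\sqrt Q : b)$.  The conditions that offer
an equality of colon ideals replace such a union by one of its two members,
which is legitimate because an ideal contained in the union of two ideals lies
in one of them ([ideal_sub_setU]); the inclusions that turn the outcome into an equality, such
as $(Q : a) \subseteq (Q : ab)$, always hold.  Choosing one of the two members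
uniformly in $c$ is exactly what is needed to let $c$ range over an ideal:
an inclusion $abI \subseteq Q$ means $I \subseteq (Q : ab)$, so a condition on
colon ideals becomes a condition on products in which one element has been
replaced by an ideal.  Repeating this for each of the three factors leads from
three elements to three ideals, and principal ideals lead back.

An inclusion of $IJ$ in an ideal can be tested on the products $xy$ with
$x \in I$ and $y \in J$; for inclusions in $\sqrt Q$ this rests on
[is_ideal_radical]. *)

Section Ideals.
Variable R : comNzRingType.
Implicit Types (I J K S : set R) (a x y z : R).

(** Were $x \in K \setminus J$ and $y \in K \setminus I$, the sum $x + y$ could
lie in neither $I$ nor $J$. *)
Lemma ideal_sub_setU I J K : is_ideal I -> is_ideal J -> is_ideal K ->
  K `<=` I `|` J -> K `<=` I \/ K `<=` J.
Proof.
have idealDr (L : set R) x y : is_ideal L -> L (x + y) -> L x -> L y.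
  move=> [_ LD LM] Lxy Lx.
  have -> : y = x + y + (-1) * x by rewrite mulN1r addrAC subrr add0r.
  exact/LD/LM.
move=> iI iJ [_ KD _] KIJ; have [KJ|] := pselect (K `<=` J).
  by right.
move=> /existsNP[x /not_implyP[Kx nJx]].
left=> y Ky; have Ix : I x by case: (KIJ _ Kx).
case: (KIJ _ Ky) => // Jy; case: (KIJ _ (KD _ _ Kx Ky)) => [Ixy|Jxy].
  exact: idealDr Ixy Ix.
by case: nJx; apply: idealDr Jy => //; rewrite addrC.
Qed.

(** In the binomial expansion of $(x + y)^{m + n}$ every term is divisible by
$x^m$ or by $y^n$. *)
Lemma is_ideal_radical I : is_ideal I -> is_ideal (radical I).
Proof.
move=> [I0 ID IM]; split=> [|x y [m m_gt0 Ixm] [n n_gt0 Iyn]|r x [n n_gt0 Ixn]].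
- by exists 1%N; rewrite ?expr1.
- exists (m + n)%N; first by rewrite addn_gt0 m_gt0.
  rewrite exprDn; apply: (big_ind I) => // i _; rewrite -mulr_natl; apply/IM.
  have [le_ni|lt_in] := leqP n i.
    by rewrite -(subnK le_ni) exprD mulrA; exact: IM.
  have le_m : (m <= m + n - i)%N by rewrite -addnBA ?leq_addr // ltnW.
  by rewrite -(subnK le_m) exprD mulrAC; exact: IM.
- by exists n => //; rewrite exprMn; exact: IM.
Qed.

Lemma colonP I S x : colon I S x <-> forall y, S y -> I (x * y).
Proof.
split=> [Ix y Sy|Ix _ [y Sy <-]]; last exact: Ix.
by apply: Ix; exists y.
Qed.

Lemma is_ideal_colon I S : is_ideal I -> is_ideal (colon I S).
Proof.
move=> [I0 ID IM]; split=> [|x y /colonP Ix /colonP Iy|r x /colonP Ix];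
  apply/colonP => z Sz.
- by rewrite mul0r.
- by rewrite mulrDl; apply: ID; [exact: Ix|exact: Iy].
- by rewrite -mulrA; apply/IM/Ix.
Qed.

Lemma is_ideal_colon_elt I a : is_ideal I -> is_ideal (colon_elt I a).
Proof.
move=> [I0 ID IM]; rewrite /colon_elt; split=> /= [|x y Ix Iy|r x Ix].
- by rewrite mul0r.
- by rewrite mulrDl; exact: ID.
- by rewrite -mulrA; exact: IM.
Qed.

Lemma ideal_mul_mem I J x y : I x -> J y -> ideal_mul I J (x * y).
Proof. by move=> Ix Jy L [_]; apply; exists x => //; exists y. Qed.

Lemma ideal_mul_sub I J K : is_ideal K ->
  (forall x y, I x -> J y -> K (x * y)) -> ideal_mul I J `<=` K.
Proof.
move=> iK KIJ; apply: smallest_sub => //.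
by move=> _ [x Ix [y Jy <-]]; exact: KIJ.
Qed.

Lemma ideal_mul_subl I J : is_ideal I -> ideal_mul I J `<=` I.
Proof.
move=> iI; apply: ideal_mul_sub => // x y Ix _.
by rewrite mulrC; case: iI => _ _; apply.
Qed.

Lemma ideal_mul_subr I J : is_ideal J -> ideal_mul I J `<=` J.
Proof.
by move=> iJ; apply: ideal_mul_sub => // x y _ Jy; case: iJ => _ _; apply.
Qed.

Lemma colonS I S S' : S `<=` S' -> colon I S' `<=` colon I S.
Proof. by move=> SS' x /colonP Ix; apply/colonP => y /SS'; exact: Ix. Qed.

Lemma is_ideal_principal a : is_ideal (range ( *%R^~ a)).
Proof.
split=> [|_ _ [x _ <-] [y _ <-]|r _ [x _ <-]].
- by exists 0; rewrite ?mul0r.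
- by exists (x + y); rewrite ?mulrDl.
- by exists (r * x); rewrite ?mulrA.
Qed.

Lemma mem_principal a : range ( *%R^~ a) a.
Proof. by exists 1; rewrite ?mul1r. Qed.

(** Divisibility by $a$ and by $b$ gives divisibility by $ab$. *)
Lemma principal_mul_sub I a b : is_ideal I -> I (a * b) ->
  ideal_mul (range ( *%R^~ a)) (range ( *%R^~ b)) `<=` I.
Proof.
move=> iI Iab; apply: ideal_mul_sub => // _ _ [x _ <-] [y _ <-].
by rewrite mulrACA; case: iI => _ _; apply.
Qed.

End Ideals.

Theorem theorem3p5 (R : comNzRingType) (Q : set R) (hQ : is_proper_ideal Q) :
  [<->
    special_2_absorbing_primary Q;

    forall a b : R,
      [\/ Q (a * b),
          colon_elt Q (a * b) = colon_elt Q a |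
          colon_elt Q (a * b) `<=` colon_elt (radical Q) b];

    forall (a b : R) (I : set R), is_ideal I ->
      elt_mul (a * b) I `<=` Q ->
      [\/ Q (a * b), elt_mul a I `<=` Q | elt_mul b I `<=` radical Q];

    forall (a : R) (I : set R), is_ideal I ->
      elt_mul a I `<=` Q \/
      colon Q (elt_mul a I) `<=` colon_elt Q a `|` colon (radical Q) I;

    forall (a : R) (I : set R), is_ideal I ->
      [\/ elt_mul a I `<=` Q,
          colon Q (elt_mul a I) = colon_elt Q a |
          colon Q (elt_mul a I) `<=` colon (radical Q) I];

    forall (a : R) (I J : set R), is_ideal I -> is_ideal J ->
      elt_mul a (ideal_mul I J) `<=` Q ->
      [\/ elt_mul a I `<=` Q,
          ideal_mul I J `<=` radical Q |
          elt_mul a J `<=` Q];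

    forall I J : set R, is_ideal I -> is_ideal J ->
      ideal_mul I J `<=` radical Q \/
      colon Q (ideal_mul I J) `<=` colon Q I `|` colon Q J;

    forall I J : set R, is_ideal I -> is_ideal J ->
      [\/ ideal_mul I J `<=` radical Q,
          colon Q (ideal_mul I J) = colon Q I |
          colon Q (ideal_mul I J) = colon Q J];

    forall I J K : set R, is_ideal I -> is_ideal J -> is_ideal K ->
      ideal_mul (ideal_mul I J) K `<=` Q ->
      [\/ ideal_mul I J `<=` radical Q,
          ideal_mul I K `<=` Q |
          ideal_mul J K `<=` Q]
  ].
Proof.
have [iQ _] := hQ; have [_ _ QM] := iQ; have irQ := is_ideal_radical iQ.
tfae.
- move=> [_ Qabs] a b; have [|nQab] := pselect (Q (a * b)); first by constructor 1.
  have [||||sub|sub] := @ideal_sub_setU _ (colon_elt Q a) (colon_elt (radical Q) b)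
      (colon_elt Q (a * b)); try exact: is_ideal_colon_elt.
  + move=> c Qcab; have [|nrcb] := pselect (radical Q (c * b)).
      by right.
    left; rewrite /colon_elt /= mulrC; apply: (Qabs b).
    * by rewrite [b * a]mulrC [_ * c]mulrC; exact: Qcab.
    * by rewrite mulrC.
    * by rewrite mulrC.
  + constructor 2; apply/seteqP; split=> // c Qca.
    by rewrite /colon_elt /= mulrA mulrC; exact: QM.
  + by constructor 3.
- move=> P a b I iI /colonP QabI.
  have subI : I `<=` colon_elt Q (a * b).
    by move=> x /QabI; rewrite /colon_elt /= mulrC.
  case: (P a b) => [Qab|eqQ|sub]; [by constructor 1|constructor 2|constructor 3];
    apply/colonP => x /subI.
  + by rewrite eqQ /colon_elt /= mulrC.
  + by move/sub; rewrite /colon_elt /= mulrC.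
- move=> P a I iI; have [|nQaI] := pselect (elt_mul a I `<=` Q); first by left.
  right=> r /colonP QraI; case: (P a r I) => // [|Qar|rI].
  + by apply/colonP => x Ix; rewrite mulrAC mulrC; apply: QraI; exists x.
  + by left; rewrite /colon_elt /= mulrC.
  + by right.
- move=> P a I iI; case: (P a I iI) => [|subU]; first by constructor 1.
  have [|||sub|sub] := ideal_sub_setU _ _ _ subU.
  + exact: is_ideal_colon_elt.
  + exact: is_ideal_colon.
  + exact: is_ideal_colon.
  + constructor 2; apply/seteqP; split=> // r Qra; apply/colonP => _ [x Ix <-].
    by rewrite mulrA mulrC; exact: QM.
  + by constructor 3.
- move=> P a I J iI iJ /colonP QaIJ.
  have subJ : J `<=` colon Q (elt_mul a I).
    move=> y Jy; apply/colonP => _ [x Ix <-].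
    by rewrite mulrCA [y * x]mulrC; apply/QaIJ; exact: ideal_mul_mem.
  case: (P a I iI) => [QaI|eqQ|sub]; [by constructor 1|constructor 3|constructor 2].
  + by apply/colonP => y /subJ; rewrite eqQ /colon_elt /= mulrC.
  + apply: ideal_mul_sub => // x y Ix /subJ/sub/colonP rIy.
    by rewrite mulrC; exact: rIy.
- move=> P I J iI iJ; have [|nIJ] := pselect (ideal_mul I J `<=` radical Q).
    by left.
  by right=> r /(P r I J iI iJ)[rI|IJ|rJ]; [left|case: nIJ|right].
- move=> P I J iI iJ; case: (P I J iI iJ) => [|subU]; first by constructor 1.
  have [|||sub|sub] := ideal_sub_setU _ _ _ subU; try exact: is_ideal_colon.
  + constructor 2; apply/seteqP; split=> //.
    by apply: colonS; exact: ideal_mul_subl.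
  + constructor 3; apply/seteqP; split=> //.
    by apply: colonS; exact: ideal_mul_subr.
- move=> P I J K iI iJ iK QIJK.
  have subK : K `<=` colon Q (ideal_mul I J).
    move=> z Kz; apply/colonP => x IJx.
    by rewrite mulrC; apply: QIJK; exact: ideal_mul_mem.
  case: (P I J iI iJ) => [|eqQ|eqQ]; [by constructor 1|constructor 2|constructor 3];
    apply: ideal_mul_sub => // x z Lx /subK; rewrite eqQ => /colonP QzL;
    by rewrite mulrC; exact: QzL.
- move=> P; split=> // a b c Qabc nQab nrac.
  (* b generates the third ideal because only the product of the first two,
     like a * c, is compared with the radical *)
  case: (P (range ( *%R^~ a)) (range ( *%R^~ c)) (range ( *%R^~ b))).
  + exact: is_ideal_principal.
  + exact: is_ideal_principal.
  + exact: is_ideal_principal.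
  + apply: ideal_mul_sub => // x _ + [z _ <-].
    have iQb : is_ideal (colon_elt Q b) by exact: is_ideal_colon_elt.
    move=> /(principal_mul_sub iQb) Qxb.
    rewrite mulrCA; apply/QM/Qxb.
    by rewrite /colon_elt /= mulrAC.
  + by move=> sub; case: nrac; apply: sub; apply: ideal_mul_mem; exact: mem_principal.
  + by move=> sub; case: nQab; apply: sub; apply: ideal_mul_mem; exact: mem_principal.
  + by move=> sub; rewrite mulrC; apply: sub; apply: ideal_mul_mem; exact: mem_principal.
Qed.
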